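(* Let $k$ be a field of characteristic $0$. The free differential perm algebra $\mathrm{DerPerm}\langle X\rangle$ over $k$ under the multiplication $a\Diamond b:=ab'-ba'$ satisfies the anti-commutative identity, the Jacobi identity, and the following identity of degree six: $$\sum_{\sigma\in S_5}(-1)^{\sigma}\,x_{\sigma(1)}\Diamond(x_{\sigma(2)}\Diamond(x_{\sigma(3)}\Diamond(x_{\sigma(4)}\Diamond(x_{\sigma(5)}\Diamond x_6))))=0,$$ for all elements $x_1,\dots,x_6$ of the algebra.
   Context: A perm algebra is an associative algebra satisfying $(ab)c=(ba)c$. The free differential perm algebra $\mathrm{DerPerm}\langle X\rangle$ on $X=\{x_1,x_2,\dots\}$ is the free perm algebra generated by the symbols $x^{(s)}$ ($x\in X$, $s\ge 0$, $x^{(0)}=x$) with the derivation $a\mapsto a'$ determined by $(x^{(s)})'=x^{(s+1)}$ and the Leibniz rule. $(-1)^\sigma$ denotes the sign of the permutation $\sigma$. *)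

(* Defs.v *)
From HB Require Import structures.
From mathcomp Require Import all_boot all_algebra.
From mathcomp Require Import boolp.

Set Implicit Arguments.
Unset Strict Implicit.
Unset Printing Implicit Defensive.

Import GRing.Theory.
Local Open Scope ring_scope.
Local Open Scope quotient_scope.

(* Perm algebras need not have a unit, so MathComp's ring and
   algebra structures do not apply. *)
HB.mixin Record isPermAlgebra (k : fieldType) A of GRing.Lmodule k A := {
  pmul : A -> A -> A;
  pmulDl : forall a b c, pmul (a + b) c = pmul a c + pmul b c;
  pmulDr : forall a b c, pmul a (b + c) = pmul a b + pmul a c;
  pmulZl : forall (t : k) a b, pmul (t *: a) b = t *: pmul a b;
  pmulZr : forall (t : k) a b, pmul a (t *: b) = t *: pmul a b;
  pmulA : forall a b c, pmul (pmul a b) c = pmul a (pmul b c);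
  pmul_perm : forall a b c, pmul (pmul a b) c = pmul (pmul b a) c
}.

#[short(type="permAlgType")]
HB.structure Definition PermAlgebra (k : fieldType) :=
  {A of isPermAlgebra k A & GRing.Lmodule k A}.

Notation "a ∘ b" := (pmul a b) (at level 40, left associativity) : ring_scope.

Definition perm_hom (k : fieldType) (A B : permAlgType k) (f : A -> B) : Prop :=
  linear f /\ (forall a b, f (a ∘ b) = f a ∘ f b).

Definition derivation (k : fieldType) (A : permAlgType k) (d : A -> A) : Prop :=
  linear d /\ (forall a b, d (a ∘ b) = d a ∘ b + a ∘ d b).

(* The free perm algebra on Y is the algebra of formal expressions in the
   elements of Y modulo the consequences of the perm algebra axioms. *)
Inductive term (k : fieldType) (Y : Type) : Type :=
| Gen of Y
| Zero
| Opp of term k Y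
| Add of term k Y & term k Y
| Scale of k & term k Y
| Mul of term k Y & term k Y.

Arguments Gen {k Y}.
Arguments Zero {k Y}.

Inductive cong (k : fieldType) (Y : Type) : term k Y -> term k Y -> Prop :=
| cong_refl a : cong a a
| cong_sym a b : cong a b -> cong b a
| cong_trans a b c : cong a b -> cong b c -> cong a c
| cong_opp a a' : cong a a' -> cong (Opp a) (Opp a')
| cong_add a a' b b' : cong a a' -> cong b b' -> cong (Add a b) (Add a' b')
| cong_scale t a a' : cong a a' -> cong (Scale t a) (Scale t a')
| cong_mul a a' b b' : cong a a' -> cong b b' -> cong (Mul a b) (Mul a' b')
| cong_addA a b c : cong (Add a (Add b c)) (Add (Add a b) c)
| cong_addC a b : cong (Add a b) (Add b a)
| cong_add0 a : cong (Add Zero a) a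
| cong_addN a : cong (Add (Opp a) a) Zero
| cong_scaleA s t a : cong (Scale s (Scale t a)) (Scale (s * t) a)
| cong_scale1 a : cong (Scale 1 a) a
| cong_scaleDr t a b : cong (Scale t (Add a b)) (Add (Scale t a) (Scale t b))
| cong_scaleDl a s t : cong (Scale (s + t) a) (Add (Scale s a) (Scale t a))
| cong_mulDl a b c : cong (Mul (Add a b) c) (Add (Mul a c) (Mul b c))
| cong_mulDr a b c : cong (Mul a (Add b c)) (Add (Mul a b) (Mul a c))
| cong_mulZl t a b : cong (Mul (Scale t a) b) (Scale t (Mul a b))
| cong_mulZr t a b : cong (Mul a (Scale t b)) (Scale t (Mul a b))
| cong_mulA a b c : cong (Mul (Mul a b) c) (Mul a (Mul b c))
| cong_perm a b c : cong (Mul (Mul a b) c) (Mul (Mul b a) c).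

HB.instance Definition _ (k : fieldType) (Y : Type) := gen_eqMixin (term k Y).
HB.instance Definition _ (k : fieldType) (Y : Type) :=
  gen_choiceMixin (term k Y).

Definition congb (k : fieldType) (Y : Type) : rel (term k Y) :=
  fun a b => `[< cong a b >].

Lemma congb_equiv (k : fieldType) (Y : Type) : equiv_class_of (@congb k Y).
Proof.
split=> [a|a b|b a c].
- by apply/asboolP; exact: cong_refl.
- by apply/asboolP/asboolP; exact: cong_sym.
- by move=> /asboolP ab /asboolP bc; apply/asboolP; exact: cong_trans ab bc.
Qed.

Canonical congb_equivRel (k : fieldType) (Y : Type) :=
  EquivRelPack (congb_equiv k Y).

Definition freePerm (k : fieldType) (Y : Type) : Type :=
  {eq_quot (@congb k Y)}.

HB.instance Definition _ (k : fieldType) (Y : Type) :=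
  Choice.on (freePerm k Y).

Definition cls (k : fieldType) (Y : Type) (a : term k Y) : freePerm k Y :=
  \pi_({eq_quot (@congb k Y)}) a.

Definition rep (k : fieldType) (Y : Type) (u : freePerm k Y) : term k Y :=
  repr (u : {eq_quot (@congb k Y)}).

Lemma clsP (k : fieldType) (Y : Type) (a b : term k Y) :
  cls a = cls b <-> cong a b.
Proof.
split=> [/eqP|ab]; first by rewrite /cls eqmodE => /asboolP.
by apply/eqP; rewrite /cls eqmodE; apply/asboolP.
Qed.

Lemma repK (k : fieldType) (Y : Type) (u : freePerm k Y) : cls (rep u) = u.
Proof. exact: reprK. Qed.

Lemma cls_rep (k : fieldType) (Y : Type) (a : term k Y) : cong (rep (cls a)) a.
Proof. by apply/clsP; rewrite repK. Qed.

Lemma clsW (k : fieldType) (Y : Type) (P : freePerm k Y -> Prop) :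
  (forall a, P (cls a)) -> forall u, P u.
Proof. by move=> Pcls u; rewrite -(repK u). Qed.

Definition fp_opp (k : fieldType) (Y : Type) (u : freePerm k Y) :=
  cls (Opp (rep u)).
Definition fp_add (k : fieldType) (Y : Type) (u v : freePerm k Y) :=
  cls (Add (rep u) (rep v)).
Definition fp_scale (k : fieldType) (Y : Type) (t : k) (u : freePerm k Y) :=
  cls (Scale t (rep u)).
Definition fp_mul (k : fieldType) (Y : Type) (u v : freePerm k Y) :=
  cls (Mul (rep u) (rep v)).

Lemma fp_oppE (k : fieldType) (Y : Type) (a : term k Y) :
  fp_opp (cls a) = cls (Opp a).
Proof. by apply/clsP/cong_opp/cls_rep. Qed.

Lemma fp_addE (k : fieldType) (Y : Type) (a b : term k Y) :
  fp_add (cls a) (cls b) = cls (Add a b).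
Proof. by apply/clsP/cong_add; exact: cls_rep. Qed.

Lemma fp_scaleE (k : fieldType) (Y : Type) (t : k) (a : term k Y) :
  fp_scale t (cls a) = cls (Scale t a).
Proof. by apply/clsP/cong_scale/cls_rep. Qed.

Lemma fp_mulE (k : fieldType) (Y : Type) (a b : term k Y) :
  fp_mul (cls a) (cls b) = cls (Mul a b).
Proof. by apply/clsP/cong_mul; exact: cls_rep. Qed.

Lemma fp_addA (k : fieldType) (Y : Type) : associative (@fp_add k Y).
Proof.
elim/clsW=> a; elim/clsW=> b; elim/clsW=> c.
by rewrite !fp_addE; apply/clsP/cong_addA.
Qed.

Lemma fp_addC (k : fieldType) (Y : Type) : commutative (@fp_add k Y).
Proof.
by elim/clsW=> a; elim/clsW=> b; rewrite !fp_addE; apply/clsP/cong_addC.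
Qed.

Lemma fp_add0 (k : fieldType) (Y : Type) : left_id (cls Zero) (@fp_add k Y).
Proof. by elim/clsW=> a; rewrite fp_addE; apply/clsP/cong_add0. Qed.

Lemma fp_addN (k : fieldType) (Y : Type) :
  left_inverse (cls Zero) (@fp_opp k Y) (@fp_add k Y).
Proof. by elim/clsW=> a; rewrite fp_oppE fp_addE; apply/clsP/cong_addN. Qed.

HB.instance Definition _ (k : fieldType) (Y : Type) :=
  GRing.isZmodule.Build (freePerm k Y)
    (@fp_addA k Y) (@fp_addC k Y) (@fp_add0 k Y) (@fp_addN k Y).

Lemma fp_scaleA (k : fieldType) (Y : Type) (s t : k) (u : freePerm k Y) :
  fp_scale s (fp_scale t u) = fp_scale (s * t) u.
Proof.
by elim/clsW: u => a; rewrite !fp_scaleE; apply/clsP/cong_scaleA.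
Qed.

Lemma fp_scale1 (k : fieldType) (Y : Type) : left_id 1 (@fp_scale k Y).
Proof. by elim/clsW=> a; rewrite fp_scaleE; apply/clsP/cong_scale1. Qed.

Lemma fp_scaleDr (k : fieldType) (Y : Type) :
  right_distributive (@fp_scale k Y) +%R.
Proof.
move=> t; elim/clsW=> a; elim/clsW=> b.
rewrite -[LHS]/(fp_scale t (fp_add _ _)) -[RHS]/(fp_add _ _).
by rewrite !(fp_scaleE, fp_addE); apply/clsP/cong_scaleDr.
Qed.

Lemma fp_scaleDl (k : fieldType) (Y : Type) (u : freePerm k Y) :
  {morph (@fp_scale k Y)^~ u : s t / s + t}.
Proof.
elim/clsW: u => a s t; rewrite -[RHS]/(fp_add _ _).
by rewrite !(fp_scaleE, fp_addE); apply/clsP/cong_scaleDl.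
Qed.

HB.instance Definition _ (k : fieldType) (Y : Type) :=
  GRing.Zmodule_isLmodule.Build k (freePerm k Y)
    (@fp_scaleA k Y) (@fp_scale1 k Y) (@fp_scaleDr k Y) (@fp_scaleDl k Y).

Lemma fp_mulDl (k : fieldType) (Y : Type) (u v w : freePerm k Y) :
  fp_mul (u + v) w = fp_mul u w + fp_mul v w.
Proof.
elim/clsW: u => a; elim/clsW: v => b; elim/clsW: w => c.
rewrite -[LHS]/(fp_mul (fp_add _ _) _) -[RHS]/(fp_add _ _).
by rewrite !(fp_mulE, fp_addE); apply/clsP/cong_mulDl.
Qed.

Lemma fp_mulDr (k : fieldType) (Y : Type) (u v w : freePerm k Y) :
  fp_mul u (v + w) = fp_mul u v + fp_mul u w.
Proof.
elim/clsW: u => a; elim/clsW: v => b; elim/clsW: w => c.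
rewrite -[LHS]/(fp_mul _ (fp_add _ _)) -[RHS]/(fp_add _ _).
by rewrite !(fp_mulE, fp_addE); apply/clsP/cong_mulDr.
Qed.

Lemma fp_mulZl (k : fieldType) (Y : Type) (t : k) (u v : freePerm k Y) :
  fp_mul (t *: u) v = t *: fp_mul u v.
Proof.
elim/clsW: u => a; elim/clsW: v => b.
rewrite -[LHS]/(fp_mul (fp_scale _ _) _) -[RHS]/(fp_scale _ _).
by rewrite !(fp_mulE, fp_scaleE); apply/clsP/cong_mulZl.
Qed.

Lemma fp_mulZr (k : fieldType) (Y : Type) (t : k) (u v : freePerm k Y) :
  fp_mul u (t *: v) = t *: fp_mul u v.
Proof.
elim/clsW: u => a; elim/clsW: v => b.
rewrite -[LHS]/(fp_mul _ (fp_scale _ _)) -[RHS]/(fp_scale _ _).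
by rewrite !(fp_mulE, fp_scaleE); apply/clsP/cong_mulZr.
Qed.

Lemma fp_mulA (k : fieldType) (Y : Type) (u v w : freePerm k Y) :
  fp_mul (fp_mul u v) w = fp_mul u (fp_mul v w).
Proof.
elim/clsW: u => a; elim/clsW: v => b; elim/clsW: w => c.
by rewrite !fp_mulE; apply/clsP/cong_mulA.
Qed.

Lemma fp_mul_perm (k : fieldType) (Y : Type) (u v w : freePerm k Y) :
  fp_mul (fp_mul u v) w = fp_mul (fp_mul v u) w.
Proof.
elim/clsW: u => a; elim/clsW: v => b; elim/clsW: w => c.
by rewrite !fp_mulE; apply/clsP/cong_perm.
Qed.

HB.instance Definition _ (k : fieldType) (Y : Type) :=
  isPermAlgebra.Build k (freePerm k Y) (@fp_mulDl k Y) (@fp_mulDr k Y)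
    (@fp_mulZl k Y) (@fp_mulZr k Y) (@fp_mulA k Y) (@fp_mul_perm k Y).

Definition gen (k : fieldType) (Y : Type) (y : Y) : freePerm k Y :=
  cls (Gen y).

Lemma cls0 (k : fieldType) (Y : Type) : cls Zero = 0 :> freePerm k Y.
Proof. by []. Qed.
Lemma clsN (k : fieldType) (Y : Type) (a : term k Y) : cls (Opp a) = - cls a.
Proof. by rewrite -fp_oppE. Qed.
Lemma clsD (k : fieldType) (Y : Type) (a b : term k Y) :
  cls (Add a b) = cls a + cls b.
Proof. by rewrite -fp_addE. Qed.
Lemma clsZ (k : fieldType) (Y : Type) (t : k) (a : term k Y) :
  cls (Scale t a) = t *: cls a.
Proof. by rewrite -fp_scaleE. Qed.
Lemma clsM (k : fieldType) (Y : Type) (a b : term k Y) :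
  cls (Mul a b) = cls a ∘ cls b.
Proof. by rewrite -fp_mulE. Qed.

Fixpoint teval (k : fieldType) (Y : Type) (B : permAlgType k) (f : Y -> B)
    (a : term k Y) : B :=
  match a with
  | Gen y => f y
  | Zero => 0
  | Opp a => - teval f a
  | Add a b => teval f a + teval f b
  | Scale t a => t *: teval f a
  | Mul a b => teval f a ∘ teval f b
  end.

Lemma teval_cong (k : fieldType) (Y : Type) (B : permAlgType k) (f : Y -> B)
  (a b : term k Y) : cong a b -> teval f a = teval f b.
Proof.
elim=> //=; try congruence.
- by move=> *; rewrite addrA.
- by move=> *; rewrite addrC.
- by move=> *; rewrite add0r.
- by move=> *; rewrite addNr.
- by move=> *; rewrite scalerA.
- by move=> *; rewrite scale1r.
- by move=> *; rewrite scalerDr.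
- by move=> *; rewrite scalerDl.
- by move=> *; rewrite pmulDl.
- by move=> *; rewrite pmulDr.
- by move=> *; rewrite pmulZl.
- by move=> *; rewrite pmulZr.
- by move=> *; rewrite pmulA.
- by move=> *; rewrite pmul_perm.
Qed.

Lemma linear_ops (k : fieldType) (U V : lmodType k) (f : U -> V) : linear f ->
  [/\ f 0 = 0, forall a, f (- a) = - f a,
      forall a b, f (a + b) = f a + f b & forall t a, f (t *: a) = t *: f a].
Proof.
move=> lf.
have fD a b : f (a + b) = f a + f b by rewrite -[a]scale1r lf !scale1r.
have f0 : f 0 = 0 by apply: (addrI (f 0)); rewrite -fD !addr0.
have fZ t a : f (t *: a) = t *: f a by rewrite -[X in f X]addr0 lf f0 addr0.
by split=> // a; rewrite -scaleN1r fZ scaleN1r.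
Qed.

Lemma freePerm_univ (k : fieldType) (Y : Type) (B : permAlgType k)
    (f : Y -> B) :
  exists! h : freePerm k Y -> B, perm_hom h /\ forall y, h (gen k y) = f y.
Proof.
pose h (u : freePerm k Y) := teval f (rep u).
have hE a : h (cls a) = teval f a by exact/teval_cong/cls_rep.
exists h; split=> [|h' [[lh' mh'] gh']].
  split; last by move=> y; rewrite hE.
  split.
    move=> t; elim/clsW=> a; elim/clsW=> b.
    by rewrite -clsZ -clsD !hE.
  by elim/clsW=> a; elim/clsW=> b; rewrite -clsM !hE.
have [h0 hN hD hZ] := linear_ops lh'.
apply/funext; elim/clsW=> a; rewrite hE.
elim: a => /= [y||a IHa|a IHa b IHb|t a IHa|a IHa b IHb].
- by rewrite -gh'.
- by rewrite cls0.
- by rewrite clsN hN IHa.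
- by rewrite clsD hD IHa IHb.
- by rewrite clsZ hZ IHa.
- by rewrite clsM mh' IHa IHb.
Qed.

(* X = {x_1, x_2, ...} is indexed from 0, and (i, s) is the symbol
   x_{i+1}^{(s)}. *)
Definition DerPerm (k : fieldType) : Type := freePerm k (nat * nat).

HB.instance Definition _ (k : fieldType) := PermAlgebra.on (DerPerm k).

Definition xgen (k : fieldType) (i s : nat) : DerPerm k := gen k (i, s).

Fixpoint tder (k : fieldType) (a : term k (nat * nat)) : term k (nat * nat) :=
  match a with
  | Gen y => Gen (y.1, y.2.+1)
  | Zero => Zero
  | Opp a => Opp (tder a)
  | Add a b => Add (tder a) (tder b)
  | Scale t a => Scale t (tder a)
  | Mul a b => Add (Mul (tder a) b) (Mul a (tder b))
  end.

Definition der (k : fieldType) (u : DerPerm k) : DerPerm k :=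
  cls (tder (rep u)).

Lemma tder_cong (k : fieldType) (a b : term k (nat * nat)) :
  cong a b -> cong (tder a) (tder b).
Proof.
move=> ab; apply/clsP; elim: ab => /=.
- by [].
- by move=> *; congruence.
- by move=> *; congruence.
- by move=> *; rewrite !clsN; congruence.
- by move=> *; rewrite !clsD; congruence.
- by move=> *; rewrite !clsZ; congruence.
- move=> c c' d d' /clsP cc' ecc' /clsP dd' edd'.
  by rewrite !(clsD, clsM) cc' ecc' dd' edd'.
- by move=> *; rewrite !clsD addrA.
- by move=> *; rewrite !clsD addrC.
- by move=> *; rewrite !clsD cls0 add0r.
- by move=> *; rewrite !clsD clsN cls0 addNr.
- by move=> *; rewrite !clsZ scalerA.
- by move=> *; rewrite !clsZ scale1r.
- by move=> *; rewrite !(clsZ, clsD) scalerDr.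
- by move=> *; rewrite !(clsZ, clsD) scalerDl.
- by move=> *; rewrite !(clsM, clsD) !pmulDl addrACA.
- by move=> *; rewrite !(clsM, clsD) !pmulDr addrACA.
- by move=> *; rewrite !(clsM, clsD, clsZ) !pmulZl scalerDr.
- by move=> *; rewrite !(clsM, clsD, clsZ) !pmulZr scalerDr.
- by move=> *; rewrite !(clsM, clsD) !pmulDl !pmulDr !pmulA addrA.
- move=> a' b' c; rewrite !(clsM, clsD) !pmulDl.
  rewrite (pmul_perm (cls (tder a'))) (pmul_perm (cls a') (cls (tder b'))).
  by rewrite (pmul_perm (cls a')) (addrC (cls b' ∘ _ ∘ _)).
Qed.

Lemma derE (k : fieldType) (a : term k (nat * nat)) :
  der (cls a : DerPerm k) = cls (tder a).
Proof. exact/clsP/tder_cong/cls_rep. Qed.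

Lemma der_derivation (k : fieldType) : derivation (@der k).
Proof.
split.
  move=> t; elim/clsW=> a; elim/clsW=> b.
  by rewrite -clsZ -clsD !derE /= clsD clsZ.
by elim/clsW=> a; elim/clsW=> b; rewrite -clsM !derE /= clsD !clsM.
Qed.

Lemma der_xgen (k : fieldType) (i s : nat) :
  der (xgen k i s) = xgen k i s.+1.
Proof. exact: derE. Qed.

Lemma der_unique (k : fieldType) (d : DerPerm k -> DerPerm k) :
  derivation d -> (forall i s, d (xgen k i s) = xgen k i s.+1) -> d = @der k.
Proof.
move=> [ld Ld] dx; have [d0 dN dD dZ] := linear_ops ld.
apply/funext; elim/clsW=> a; rewrite derE.
elim: a => /= [[i s]||a IHa|a IHa b IHb|t a IHa|a IHa b IHb].
- exact: dx.
- by rewrite cls0 d0.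
- by rewrite !clsN dN IHa.
- by rewrite !clsD dD IHa IHb.
- by rewrite !clsZ dZ IHa.
- by rewrite clsM Ld IHa IHb clsD !clsM.
Qed.

Lemma DerPerm_univ (k : fieldType) (B : permAlgType k) (dB : B -> B)
    (f : nat -> B) : derivation dB ->
  exists! h : DerPerm k -> B,
    [/\ perm_hom h, forall u, h (der u) = dB (h u)
      & forall i, h (xgen k i 0) = f i].
Proof.
move=> [ldB LdB]; have [dB0 dBN dBD dBZ] := linear_ops ldB.
have [h [[[lh mh] gh] uh]] :=
  freePerm_univ (fun y : nat * nat => iter y.2 dB (f y.1)).
have [h0 hN hD hZ] := linear_ops lh.
exists h; split=> [|h' [[lh' mh'] dh' gh']].
  split=> //; last by move=> i; exact: gh.
  elim/clsW=> a; rewrite derE.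
  elim: a => /= [[i s]||a IHa|a IHa b IHb|t a IHa|a IHa b IHb].
  - by rewrite -!/(gen k _) !gh.
  - by rewrite cls0 h0 dB0.
  - by rewrite !clsN !hN dBN IHa.
  - by rewrite !clsD !hD dBD IHa IHb.
  - by rewrite !clsZ !hZ dBZ IHa.
  - by rewrite clsD !clsM hD !mh LdB IHa IHb.
apply: uh; split=> [//|[i s] /=].
elim: s => [|s IHs] /=; first exact: gh'.
by rewrite -IHs -[gen k (i, s.+1)]/(xgen k i s.+1) -der_xgen dh'.
Qed.

Definition diamond (k : fieldType) (a b : DerPerm k) : DerPerm k :=
  a ∘ der b - b ∘ der a.

Notation "a ◇ b" := (diamond a b) (at level 40, left associativity) : ring_scope.

(* Main.v *)
Require Import Defs.
From mathcomp Require Import all_boot all_fingroup all_algebra.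
From mathcomp Require Import zify.

Import GRing.Theory.
Local Open Scope ring_scope.

(** In a perm algebra the left multiplications commute, so a product of
    derivatives of elements depends only on its last factor and on the multiset
    of the other ones. The sextic identity is a sum of products in which each of
    x_1, ..., x_6 occurs once and the orders of derivation add up to 5. At least
    four of x_1, ..., x_5 are not the last factor; were their orders distinct,
    the orders would add up to at least 0 + 1 + 2 + 3 = 6. So two of them have
    the same order, and alternation over S_5 kills the product. *)

Section PermAlgebraTheory.

Context {k : fieldType} {A : permAlgType k}.
Implicit Types a b c : A.

Lemma pmulNl a b : (- a) ∘ b = - (a ∘ b).
Proof. by rewrite -scaleN1r pmulZl scaleN1r. Qed.

Lemma pmulNr a b : a ∘ (- b) = - (a ∘ b).
Proof. by rewrite -scaleN1r pmulZr scaleN1r. Qed.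

Lemma pmulCA a b c : a ∘ (b ∘ c) = b ∘ (a ∘ c).
Proof. by rewrite -!pmulA pmul_perm. Qed.

(** With [d := @der k] this is [diamond]. *)
Definition wronskian (d : A -> A) a b := a ∘ d b - b ∘ d a.

Lemma wronskianC d a b : wronskian d a b = - wronskian d b a.
Proof. by rewrite opprB. Qed.

Lemma wronskian_jacobi d a b c : derivation d ->
  wronskian d (wronskian d a b) c + wronskian d (wronskian d b c) a
    + wronskian d (wronskian d c a) b = 0.
Proof.
move=> [ld dM]; have [_ dN dD _] := linear_ops ld.
(* The six terms are paired so that each of the three differences telescopes to 0 when summed over
   the cyclic shifts of its arguments. *)
have wwE x y z : wronskian d (wronskian d x y) z =
    (x ∘ (d y ∘ d z) - z ∘ (d x ∘ d y))
    + (z ∘ (d y ∘ d x) - y ∘ (d x ∘ d z))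
    + (y ∘ (z ∘ d (d x)) - z ∘ (x ∘ d (d y))).
  rewrite /wronskian dD dN !dM !(pmulDl, pmulDr, pmulNl, pmulNr) !pmulA.
  rewrite (pmulCA z y) !(opprD, opprK).
  by rewrite [LHS](AC (2*(2*2)) (1*3*(5*2)*(6*4)))%AC.
rewrite !wwE.
have telescope (V : zmodType) (p q r : V) : (p - q) + (q - r) + (r - p) = 0.
  by rewrite !addrA !subrK subrr.
rewrite [LHS](AC (3*3*3) ((1*7*4)*(2*8*5)*(3*6*9)))%AC /=.
by rewrite !telescope !addr0.
Qed.

End PermAlgebraTheory.

Section Words.

Context {k : fieldType} {A : permAlgType k} {I : eqType} (d : A -> A).
Hypothesis d_der : derivation d.
Implicit Types (y : I -> A) (p l : I * nat) (s : seq (I * nat)) (V : seq I).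

(* The letter (i, n) stands for the n-th derivative of the i-th element. *)
Definition letter y p : A := iter p.2 d (y p.1).

Definition word y s l : A := foldr (fun p u => letter y p ∘ u) (letter y l) s.

Lemma word_cons y p s l : word y (p :: s) l = letter y p ∘ word y s l.
Proof. by []. Qed.

Lemma word_rcons y s l p : word y (rcons s l) p = word y s l ∘ letter y p.
Proof. by elim: s => //= q s IHs; rewrite -[LHS]/(_ ∘ _) IHs pmulA. Qed.

Lemma perm_word y s1 s2 l : perm_eq s1 s2 -> word y s1 l = word y s2 l.
Proof.
rewrite /word; elim: s1 s2 => [|p s1 IHs1] s2.
  by rewrite perm_sym => /perm_nilP ->.
move=> ps; have ps2 : p \in s2 by rewrite -(perm_mem ps) mem_head.
case/splitPr: s2 / ps2 ps => u v ps.
have /IHs1 /= -> : perm_eq s1 (u ++ v).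
  by rewrite -(perm_cons p) (perm_trans ps) // (perm_catCA u [:: p]).
elim: u {ps} => //= q u IHu; rewrite -IHu; exact: pmulCA.
Qed.

Lemma eq_word y y' s l :
  {in l :: s, forall p, y p.1 = y' p.1} -> word y s l = word y' s l.
Proof.
elim: s => [|p s IHs] eqy; first by rewrite /word /= /letter eqy ?mem_head.
rewrite !word_cons /letter eqy ?inE ?eqxx ?orbT // IHs // => q.
by rewrite inE => /orP[/eqP->|qs]; apply: eqy; rewrite !inE ?eqxx ?qs ?orbT.
Qed.

(* The linear span of the words in which the indices in V occur once each and
   the orders of derivation add up to n. *)
Inductive wspan V n : ((I -> A) -> A) -> Prop :=
| wspan_word s l : perm_eq [seq p.1 | p <- l :: s] V ->
    sumn [seq p.2 | p <- l :: s] = n -> wspan V n (fun y => word y s l)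
| wspan_add F G : wspan V n F -> wspan V n G -> wspan V n (fun y => F y + G y)
| wspan_opp F : wspan V n F -> wspan V n (fun y => - F y)
| wspan_ext F G : (forall y, F y = G y) -> wspan V n F -> wspan V n G.

Lemma wspan_perm V V' n F : perm_eq V V' -> wspan V n F -> wspan V' n F.
Proof.
move=> VV'; elim=> [s l pV nE|f g _ Hf _ Hg|f _ Hf|f g fg _ Hf].
- by apply: wspan_word => //; exact: perm_trans pV VV'.
- exact: wspan_add.
- exact: wspan_opp.
- exact: wspan_ext fg Hf.
Qed.

Lemma wspan_mul p V n F : wspan V n F ->
  wspan (p.1 :: V) (p.2 + n) (fun y => letter y p ∘ F y).
Proof.
elim=> [s l pV nE|f g _ Hf _ Hg|f _ Hf|f g fg _ Hf].
- apply: (wspan_word _ _ (p :: s) l) => /=; last by rewrite -nE /= addnCA.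
  move: pV; rewrite -(perm_cons p.1); apply: perm_trans.
  by rewrite (perm_catCA [:: l.1] [:: p.1]).
- by apply: wspan_ext (wspan_add _ _ _ _ Hf Hg) => y; rewrite pmulDr.
- by apply: wspan_ext (wspan_opp _ _ _ Hf) => y; rewrite pmulNr.
- by apply: wspan_ext Hf => y; rewrite fg.
Qed.

(** By the Leibniz rule, [d] falls on one letter of a word at a time and raises its order by one. *)
Lemma wspan_d V n F : wspan V n F -> wspan V n.+1 (fun y => d (F y)).
Proof.
have [ld dM] := d_der; have [_ dN dD _] := linear_ops ld.
elim=> [s l pV nE|f g _ Hf _ Hg|f _ Hf|f g fg _ Hf].
- apply: wspan_perm pV _; rewrite -{}nE {n V}.
  elim: s => [|p s IHs].
    apply: (wspan_ext _ _ (fun y => word y [::] (l.1, l.2.+1))) => //.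
    exact: wspan_word.
  have pVs : perm_eq (p.1 :: [seq q.1 | q <- l :: s])
                     [seq q.1 | q <- l :: p :: s].
    by rewrite (perm_catCA [:: p.1] [:: l.1]).
  apply: wspan_perm pVs _.
  have -> : (sumn [seq q.2 | q <- l :: p :: s]).+1 =
            (p.2 + (sumn [seq q.2 | q <- l :: s]).+1)%N by rewrite /=; lia.
  (* In [H1] the derivation falls on the tail of the word, in [H2] on its first letter. *)
  have H1 := wspan_mul p _ _ _ IHs.
  have H2 := wspan_mul (p.1, p.2.+1) _ _ _ (wspan_word _ _ s l (perm_refl _) erefl).
  rewrite addSnnS in H2.
  by apply: wspan_ext (wspan_add _ _ _ _ H2 H1) => y; rewrite word_cons dM.
- by apply: wspan_ext (wspan_add _ _ _ _ Hf Hg) => y; rewrite dD.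
- by apply: wspan_ext (wspan_opp _ _ _ Hf) => y; rewrite dN.
- by apply: wspan_ext Hf => y; rewrite fg.
Qed.

(** The new letter of order 1 becomes the last factor, and the old last factor joins the commuting
    ones. *)
Lemma wspan_mul_d i V n F : wspan V n F ->
  wspan (i :: V) n.+1 (fun y => F y ∘ d (y i)).
Proof.
elim=> [s l pV nE|f g _ Hf _ Hg|f _ Hf|f g fg _ Hf].
- apply: (wspan_ext _ _ (fun y => word y (rcons s l) (i, 1%N))).
    by move=> y; rewrite word_rcons.
  apply: wspan_word => /=; last first.
    by rewrite map_rcons sumn_rcons -nE /= add1n addnC.
  by rewrite perm_cons -(permPr pV) map_rcons perm_rcons.
- by apply: wspan_ext (wspan_add _ _ _ _ Hf Hg) => y; rewrite pmulDl.
- by apply: wspan_ext (wspan_opp _ _ _ Hf) => y; rewrite pmulNl.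
- by apply: wspan_ext Hf => y; rewrite fg.
Qed.

Lemma wspan_wronskian i V n F : wspan V n F ->
  wspan (i :: V) n.+1 (fun y => wronskian d (y i) (F y)).
Proof.
move=> HF; apply: wspan_add; last exact/wspan_opp/wspan_mul_d.
exact: (wspan_mul (i, 0%N) _ _ _ (wspan_d _ _ _ HF)).
Qed.

End Words.

(** The bound is 0 + 1 + ... + ([size t] - 1). By pigeonhole, n + 1 distinct numbers include one
    that is at least n; removing it gives the induction. *)
Lemma leq_sumn_uniq (t : seq nat) : uniq t -> ('C(size t, 2) <= sumn t)%N.
Proof.
move: {2}(size t) (erefl (size t)) => n; elim: n t => [|n IHn] t szt ut.
  by rewrite szt.
have /hasP[m mt nm] : has (leq n) t.
  apply: contraT => /hasPn lt_n.
  have /(uniq_leq_size ut) : {subset t <= iota 0 n}.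
    by move=> m /lt_n; rewrite mem_iota add0n -ltnNge.
  by rewrite size_iota szt ltnn.
have szr : size (rem m t) = n by rewrite size_rem // szt.
have := IHn _ szr (rem_uniq _ ut).
rewrite (perm_sumn (perm_to_rem mt)) szt szr binS bin1 /=; lia.
Qed.

(** Multiplication by the transposition matches odd permutations with even ones, so the two halves
    of the sum cancel. *)
Lemma alternating_sum_eq0 {k : fieldType} {V : lmodType k} (T : finType)
    (i j : T) (f : {perm T} -> V) :
  i != j -> (forall s, f (tperm i j * s)%g = f s) ->
  \sum_(s : {perm T}) (-1) ^+ s *: f s = 0.
Proof.
move=> ij ft; rewrite (bigID (@odd_perm T)) /=.
rewrite (reindex_inj (mulgI (tperm i j))) /=.
apply/eqP; rewrite addr_eq0 -sumrN; apply/eqP; apply: eq_big => s.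
  by rewrite odd_permM odd_tperm ij addTb.
by rewrite odd_permM odd_tperm ij addTb ft => /negbTE->; rewrite !scaleN1r scale1r.
Qed.

Section AlternatingWords.

Context {k : fieldType} {A : permAlgType k} (d : A -> A) {m : nat}.
Variables (x : 'I_m -> A) (z : A).

(* The index None stands for the element that does not take part in the
   alternation. *)
Definition permuted (s : 'S_m) (o : option 'I_m) : A :=
  if o is Some i then x (s i) else z.

(** Composing with the transposition of i and j swaps two letters of equal order, neither of them
    last, and these commute. *)
Lemma alternating_word_eq0 s l i j n : uniq [seq p.1 | p <- l :: s] ->
    i != j -> (Some i, n) \in s -> (Some j, n) \in s ->
  \sum_(t : 'S_m) (-1) ^+ t *: word d (permuted t) s l = 0.
Proof.
move=> us ij si sj; apply: (alternating_sum_eq0 _ i j) => // t.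
have us' : uniq s by have /andP[_ /map_uniq] := us.
pose r := rem (Some j, n) (rem (Some i, n) s).
have ps : perm_eq s [:: (Some i, n), (Some j, n) & r].
  rewrite (perm_trans (perm_to_rem si)) // perm_cons perm_to_rem //.
  by rewrite mem_rem_uniq // inE sj xpair_eqE (inj_eq Some_inj) eq_sym (negbTE ij).
(* Uniqueness of indices keeps i and j out of [l] and [r], so the transposition leaves those letters
   alone. *)
have := us; rewrite map_cons cons_uniq (perm_mem (perm_map _ ps)).
rewrite (perm_uniq (perm_map _ ps)) /= !inE !negb_or => /and4P[].
move=> /and3P[li lj _] /andP[_ ir] jr _.
rewrite !(perm_word _ _ _ _ _ ps) !word_cons pmulCA /letter /=.
rewrite !permM tpermL tpermR; congr (_ ∘ (_ ∘ _)).
apply: eq_word => -[[h|//] e] /(map_f fst); rewrite inE /= => hr.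
rewrite permM tpermD //; apply: contraTneq hr => <-.
  by rewrite negb_or eq_sym li.
by rewrite negb_or eq_sym lj.
Qed.

Lemma alternating_wspan_eq0 n F : (n < 'C(m.-1, 2))%N ->
    wspan d (None :: [seq Some i | i <- enum 'I_m]) n F ->
  \sum_(s : 'S_m) (-1) ^+ s *: F (permuted s) = 0.
Proof.
move=> lt_n; elim=> [s l pV nE|f g _ Hf _ Hg|f _ Hf|f g fg _ Hf].
- have us : uniq [seq p.1 | p <- l :: s].
    rewrite (perm_uniq pV) /= map_inj_uniq ?enum_uniq ?andbT; last exact: Some_inj.
    by apply/mapP => -[].
  have szs : size s = m.
    by have := perm_size pV; rewrite /= !size_map -enumT size_enum_ord => -[].
  pose some (p : option 'I_m * nat) := isSome p.1.
  pose f := filter some s.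
  have uf : uniq [seq p.1 | p <- f].
    by apply: subseq_uniq (map_subseq fst (filter_subseq _ s)) _; case/andP: us.
  (* [s] has m letters, and at most one of them has index [None]. *)
  have szf : (m.-1 <= size f)%N.
    have: (size f + count_mem None [seq p.1 | p <- s])%N = m.
      apply: etrans szs; rewrite -(count_predC some s) size_filter count_map.
      by congr addn; apply: eq_count => -[[]].
    rewrite count_uniq_mem; last by case/andP: us.
    by case: (_ \in _); lia.
  have le_f : (sumn [seq p.2 | p <- f] <= n)%N.
    rewrite -nE /= (leq_trans _ (leq_addl _ _)) // /f.
    by elim: (s) => //= p s' IHs; rewrite {1}/some; case: p.1 => [?|] /=; lia.
  (* Distinct orders would add up to at least ['C(m.-1, 2)], which exceeds n. *)
  have /(uniqPn 0%N)[a [b [ab]]] : ~~ uniq [seq p.2 | p <- f].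
    apply: contraL lt_n => /leq_sumn_uniq; rewrite size_map -leqNgt => le_s.
    by rewrite (leq_trans _ (leq_trans le_s le_f)) // leq_bin2l.
  rewrite size_map => bf; have af := ltn_trans ab bf.
  rewrite !(nth_map (None, 0%N)) // => eab.
  have [+ +] := (mem_nth (None, 0%N) af, mem_nth (None, 0%N) bf).
  have : (nth (None, 0%N) f a).1 != (nth (None, 0%N) f b).1.
    rewrite -!(nth_map _ None fst) // nth_uniq ?size_map //.
    by rewrite neq_ltn ab.
  case: (nth _ f a) (nth _ f b) eab => [[i|] e] [[j|] _] /= <-;
    rewrite ?mem_filter //= (inj_eq Some_inj) => ij si sj.
  exact: alternating_word_eq0 us ij si sj.
- by under eq_bigr do rewrite scalerDr; rewrite big_split /= Hf Hg addr0.
- by under eq_bigr do rewrite scalerN; rewrite sumrN Hf oppr0.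
- by under eq_bigr do rewrite -fg.
Qed.

End AlternatingWords.

Theorem proposition7p1 (k : fieldType) (char0 : [pchar k] =i pred0) :
  [/\ forall a b : DerPerm k, a ◇ b = - (b ◇ a),
      forall a b c : DerPerm k,
        (a ◇ b) ◇ c + (b ◇ c) ◇ a + (c ◇ a) ◇ b = 0
    & forall (x : 'I_5 -> DerPerm k) (x6 : DerPerm k),
        \sum_(s : 'S_5) (-1) ^+ s *:
          (x (s (inord 0)) ◇ (x (s (inord 1)) ◇ (x (s (inord 2)) ◇
            (x (s (inord 3)) ◇ (x (s (inord 4)) ◇ x6))))) = 0].
Proof.
have d_der := der_derivation k.
split=> [a b|a b c|x x6]; first exact: wronskianC; first exact: wronskian_jacobi.
pose ad i (F : (option 'I_5 -> DerPerm k) -> DerPerm k) y :=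
  wronskian (@der k) (y (Some (inord i))) (F y).
have H0 : wspan (@der k) [:: None] 0 (fun y : option 'I_5 -> DerPerm k => y None).
  exact: (wspan_word _ _ _ [::] (None, 0%N)).
have {H0} H : wspan (@der k) (None :: [seq Some i | i <- enum 'I_5]) 5
    (ad 0 (ad 1 (ad 2 (ad 3 (ad 4 (fun y => y None))))))%N.
  apply: wspan_perm; last by do 5!apply: wspan_wronskian => //; exact: H0.
  (* The nested brackets collect the indices 0, ..., 4 in this order, followed by [None] for
     [x6]. *)
  pose ords : seq 'I_5 := [seq inord i | i <- iota 0 5].
  rewrite -[X in perm_eq X _]/(map Some ords ++ [:: None]).
  rewrite perm_catC perm_cons perm_map // /ords -val_enum_ord -map_comp.
  by rewrite map_id_in // => i _; exact: inord_val.
(* The remaining side condition is 5 < ['C(4, 2)] = 6, which holds by computation. *)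
exact: (alternating_wspan_eq0 (@der k) x x6 _ _ _ H).
Qed.
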